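(* Let $\mathfrak B$ be the set of the twelve tournaments $C_3.\omega$, $C_3.\omega^*$, $V_{[\omega]}$, $V_{[\omega^*]}$, $T_{[\omega]}$, $T_{[\omega^*]}$, $U_{[\omega]}$, $U_{[\omega^*]}$, $H_{[\omega]}$, $H_{[\omega^*]}$, $K_{[\omega]}$, $K_{[\omega^*]}$, and let $\check K_{[\omega]}$ denote the tournament induced by $K_{[\omega]}$ on its vertex set minus the vertex $(0,0)$. The twelve tournaments obtained from $\mathfrak B$ by replacing $K_{[\omega]}$ by $\check K_{[\omega]}$ are infinite acyclically indecomposable tournaments, and every infinite acyclically indecomposable tournament contains a subtournament isomorphic to one of these twelve tournaments.
   Context: A tournament is a set with an irreflexive, antisymmetric, complete binary relation (edges, written $u\to v$). It is acyclic if it has no $3$-cycle. A subset $A$ of vertices is autonomous if every vertex outside $A$ either dominates all of $A$ or is dominated by all of $A$. A tournament is acyclically indecomposable if no autonomous subset inducing an acyclic tournament has more than one element. A subtournament is the tournament induced on a subset of vertices. For a chain (acyclic tournament) $C=(A,<)$ (edge $x\to y$ iff $x<y$) define: - $C_3.C$: vertex set $A\times\{0,1,2\}$, with $(x,i)\to(y,j)$ iff $x<y$, or $x=y$ and $j\equiv i+1 \pmod 3$ (copies of the $3$-cycle arranged along $C$). - $V_{[C]}$: vertex set $(A\times\{0,1\})\cup\{a\}$ with $a$ a new vertex; $(x,i)\to(x',i')$ iff $x<x'$ or ($x=x'$ and $i<i'$); and $a\to(x,0)$, $(x,1)\to a$ for all $x\in A$. - $T_{[C]},U_{[C]},H_{[C]},K_{[C]}$: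 vertex set $A\times\{0,1\}$; in all four, $(x,0)\to(x,1)$ for every $x\in A$ and $(x,0)\to(y,0)$ whenever $x<y$; in addition, for all $x<y$ in $A$: $T_{[C]}$: $(x,1)\to(y,1)$, $(y,1)\to(x,0)$, $(y,0)\to(x,1)$; $U_{[C]}$: $(y,1)\to(x,1)$, $(x,0)\to(y,1)$, $(x,1)\to(y,0)$; $H_{[C]}$: $(x,1)\to(y,1)$, $(y,1)\to(x,0)$, $(x,1)\to(y,0)$; $K_{[C]}$: $(y,1)\to(x,1)$, $(y,1)\to(x,0)$, $(x,1)\to(y,0)$. Here $\omega=(\mathbb N,<)$ and $\omega^*$ is its dual ($\mathbb N$ with the reversed order). *)

(* Defs.v *)
From mathcomp Require Export all_boot.
From mathcomp Require Export boolp classical_sets functions cardinality.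

Set Implicit Arguments.
Unset Strict Implicit.
Unset Printing Implicit Defensive.

Local Open Scope classical_set_scope.

Record digraph := Digraph { vertex :> Type; arc : vertex -> vertex -> Prop }.

Record is_tournament (T : digraph) : Prop := IsTournament {
  tournament_irreflexive : forall x : T, ~ arc x x;
  tournament_antisymmetric : forall x y : T, arc x y -> arc y x -> x = y;
  tournament_complete : forall x y : T, x <> y -> arc x y \/ arc y x }.

Definition acyclic (T : digraph) : Prop :=
  forall x y z : T, ~ [/\ arc x y, arc y z & arc z x].

Definition induced (T : digraph) (A : set T) : digraph :=
  @Digraph A (fun x y => arc (val x) (val y)).

Definition autonomous (T : digraph) (A : set T) : Prop :=
  forall v : T, ~ A v ->
    (forall a, A a -> arc v a) \/ (forall a, A a -> arc a v).

Definition acyclically_indecomposable (T : digraph) : Prop :=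
  forall A : set T, autonomous A -> acyclic (induced A) -> is_subset1 A.

Definition isomorphic (T U : digraph) : Prop :=
  exists2 f : T -> U, bijective f & forall x y, arc x y <-> arc (f x) (f y).

Definition contains (T U : digraph) : Prop :=
  exists A : set T, isomorphic (induced A) U.

Definition omega : digraph := @Digraph nat (fun m n => (m < n)%N).
Definition omega_star : digraph := @Digraph nat (fun m n => (n < m)%N).

(* The constructions below are meant for a chain C, whose strict order x < y
   is [arc x y]. The labels 0 and 1 of the vertex set A x {0,1} are the
   booleans [false] and [true]. *)

Definition C3_dot (C : digraph) : digraph :=
  @Digraph (C * 'I_3) (fun u v =>
    arc u.1 v.1 \/ (u.1 = v.1 /\ v.2 = u.2 + 1 %[mod 3])).

(* The extra vertex a of V_[C] is [None]. *)
Definition V_ (C : digraph) : digraph :=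
  @Digraph (option (C * bool)) (fun u v =>
    match u, v with
    | Some (x, i), Some (x', i') => arc x x' \/ (x = x' /\ (i < i')%N)
    | None, Some (_, i) => i = false
    | Some (_, i), None => i = true
    | None, None => False
    end).

Variant T_arc (C : digraph) : C * bool -> C * bool -> Prop :=
| T_vert x : T_arc (x, false) (x, true)
| T_base x y : arc x y -> T_arc (x, false) (y, false)
| T_top x y : arc x y -> T_arc (x, true) (y, true)
| T_cross1 x y : arc x y -> T_arc (y, true) (x, false)
| T_cross2 x y : arc x y -> T_arc (y, false) (x, true).

Variant U_arc (C : digraph) : C * bool -> C * bool -> Prop :=
| U_vert x : U_arc (x, false) (x, true)
| U_base x y : arc x y -> U_arc (x, false) (y, false)
| U_top x y : arc x y -> U_arc (y, true) (x, true)
| U_cross1 x y : arc x y -> U_arc (x, false) (y, true)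
| U_cross2 x y : arc x y -> U_arc (x, true) (y, false).

Variant H_arc (C : digraph) : C * bool -> C * bool -> Prop :=
| H_vert x : H_arc (x, false) (x, true)
| H_base x y : arc x y -> H_arc (x, false) (y, false)
| H_top x y : arc x y -> H_arc (x, true) (y, true)
| H_cross1 x y : arc x y -> H_arc (y, true) (x, false)
| H_cross2 x y : arc x y -> H_arc (x, true) (y, false).

Variant K_arc (C : digraph) : C * bool -> C * bool -> Prop :=
| K_vert x : K_arc (x, false) (x, true)
| K_base x y : arc x y -> K_arc (x, false) (y, false)
| K_top x y : arc x y -> K_arc (y, true) (x, true)
| K_cross1 x y : arc x y -> K_arc (y, true) (x, false)
| K_cross2 x y : arc x y -> K_arc (x, true) (y, false).

Definition T_ (C : digraph) : digraph := Digraph (@T_arc C).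
Definition U_ (C : digraph) : digraph := Digraph (@U_arc C).
Definition H_ (C : digraph) : digraph := Digraph (@H_arc C).
Definition K_ (C : digraph) : digraph := Digraph (@K_arc C).

Definition K_check_omega : digraph :=
  @induced (K_ omega) (~` [set (0%N, false)]).

(* The twelve tournaments, with K in the place of K_[omega]. An inductive
   predicate is used because [set digraph] is a universe inconsistency, the
   universe of [vertex] being that of the argument of [set]. *)
Variant basis_with (K : digraph) : digraph -> Prop :=
| basis_C3_omega : basis_with K (C3_dot omega)
| basis_C3_omega_star : basis_with K (C3_dot omega_star)
| basis_V_omega : basis_with K (V_ omega)
| basis_V_omega_star : basis_with K (V_ omega_star)
| basis_T_omega : basis_with K (T_ omega)
| basis_T_omega_star : basis_with K (T_ omega_star)
| basis_U_omega : basis_with K (U_ omega)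
| basis_U_omega_star : basis_with K (U_ omega_star)
| basis_H_omega : basis_with K (H_ omega)
| basis_H_omega_star : basis_with K (H_ omega_star)
| basis_K : basis_with K K
| basis_K_omega_star : basis_with K (K_ omega_star).

Definition basis : digraph -> Prop := basis_with (K_ omega).
Definition basis_check : digraph -> Prop := basis_with K_check_omega.

(* Main.v *)
Require Import Defs.
From mathcomp Require Import zify.

(** Call two distinct vertices equivalent when some acyclic autonomous set
    contains both. If x -> y are not equivalent, at most three further vertices
    show it: a 3-cycle through x and y, or a 3-cycle lying between x and y, or a
    vertex between x and y together with one outside that separates it from both.
    In an infinite acyclically indecomposable tournament, Ramsey's theorem gives
    a monotone sequence; pair up its consecutive terms, attach to each pair such
    a witness, and apply Ramsey's theorem again, so that the arcs between the
    m-th and the n-th block (m < n) depend only on the labels of the two vertices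
    in their blocks. There are finitely many such homogeneous tables for each
    kind of witness, and each of them contains one of the twelve tournaments, its
    block x being sent into the blocks 2x and 2x + 1. This last finite statement
    is checked by computation. *)

Set Implicit Arguments.
Unset Strict Implicit.
Unset Printing Implicit Defensive.

Local Open Scope classical_set_scope.

(** * Tournament axioms and infinity of the twelve members of the basis *)

Lemma tournamentI (T : digraph) : (forall x y : T, arc x y -> ~ arc y x) ->
  (forall x y : T, x <> y -> arc x y \/ arc y x) -> is_tournament T.
Proof.
by move=> asym total; split=> // [x xx | x y /asym//]; exact: (asym _ _ xx xx).
Qed.

Lemma tournament_asym (T : digraph) (x y : T) :
  is_tournament T -> arc x y -> ~ arc y x.
Proof.
by case=> irr anti _ xy yx; apply: (irr x); rewrite {2}(anti _ _ xy yx).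
Qed.

(** A vertex outside an autonomous set cannot receive an arc from it and send one back, so such a
    set is closed under betweenness. If two of its vertices lie on a 3-cycle, the third therefore
    belongs to it too, against acyclicity; hence the third vertex [w] ranges over all of [T] in the
    second clause. *)
Lemma indecomposableI (T : digraph) : is_tournament T ->
    (forall A : set T,
       (forall u v w, A u -> A v -> arc u w -> arc w v -> A w) ->
       (forall u v w, A u -> A v -> arc u v -> arc v w -> ~ arc w u) ->
     forall u v, A u -> A v -> ~ arc u v) ->
  acyclically_indecomposable T.
Proof.
move=> tourT noarc A autA acA u v Au Av; have [_ _ total] := tourT.
have closed a b c : A a -> A b -> arc a c -> arc c b -> A c.
  move=> Aa Ab ac cb; apply: contrapT => /autA[/(_ a Aa)|/(_ b Ab)];
    exact: tournament_asym.
have nocycle a b c : A a -> A b -> arc a b -> arc b c -> ~ arc c a.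
  move=> Aa Ab ab bc ca; have Ac : A c by apply: closed bc ca.
  by apply: (acA (SigSub (mem_set Aa)) (SigSub (mem_set Ab))
                 (SigSub (mem_set Ac))); split.
by apply: contrapT => /total[]; apply: noarc closed nocycle _ _ _ _.
Qed.

Lemma infinite_injective (T : Type) (f : nat -> T) :
  injective f -> infinite_set [set: T].
Proof.
move=> f_inj /(finite_preimage (f := f)) fin; apply: infinite_nat.
by rewrite -(preimage_setT f); apply: fin => x y _ _; apply: f_inj.
Qed.

Lemma omega_tournament : is_tournament omega.
Proof.
by apply: tournamentI => m n /=; [lia | move/eqP; rewrite neq_ltn => /orP].
Qed.

Lemma omega_star_tournament : is_tournament omega_star.
Proof.
apply: tournamentI => m n /=; first lia.
by move/eqP; rewrite neq_ltn => /orP[]; auto.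
Qed.

Lemma induced_tournament (T : digraph) (A : set T) :
  is_tournament T -> is_tournament (induced A).
Proof.
move=> tourT; have [_ _ total] := tourT.
apply: tournamentI => [x y xy|x y xNy]; first exact: (tournament_asym tourT xy).
by apply: total => /val_inj.
Qed.

Lemma TUHK_tournament (C : digraph) : is_tournament C ->
  [/\ is_tournament (T_ C), is_tournament (U_ C), is_tournament (H_ C)
    & is_tournament (K_ C)].
Proof.
move=> tourC; have [irr _ total] := tourC.
have asym (x y : C) : arc x y -> arc y x -> False.
  by move=> xy; apply: tournament_asym.
split; apply: tournamentI.
all: try by move=> u v uv vu; destruct uv; inversion vu; subst; eauto.
all: move=> [x i] [y j]; have [->|xNy] := pselect (x = y).
all: try by case: i; case: j => // _;
  solve [left; constructor; assumption | right; constructor; assumption].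
all: by case: (total x y xNy); case: i; case: j => xy _;
  solve [left; constructor; assumption | right; constructor; assumption].
Qed.

Lemma C3_dot_tournament (C : digraph) : is_tournament C ->
  is_tournament (C3_dot C).
Proof.
move=> tourC; have [irr _ total] := tourC.
apply: tournamentI => [[x i] [y j]|[x i] [y j] xNy] /=.
  case=> [xy|[-> ji]] [yx|[yx ij]]; first exact: (tournament_asym tourC xy yx).
  - by subst y; apply: irr xy.
  - exact: irr yx.
  - by have := ltn_ord i; have := ltn_ord j; lia.
have [eq_xy|/total[]] := pselect (x = y); [|by left; left|by right; left].
subst y; have iNj : i <> j :> nat.
  by move=> /val_inj eq_ij; apply: xNy; rewrite eq_ij.
have [ij|ji] : j = i + 1 %[mod 3] \/ i = j + 1 %[mod 3].
- by have := ltn_ord i; have := ltn_ord j; lia.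
- by left; right.
- by right; right.
Qed.

Lemma V_tournament (C : digraph) : is_tournament C -> is_tournament (V_ C).
Proof.
move=> tourC; have [irr _ total] := tourC.
apply: tournamentI => [[[x i]|] [[y j]|]|[[x i]|] [[y j]|]] //=.
- case=> [xy|[-> ij]] [yx|[yx ji]]; first exact: (tournament_asym tourC xy yx).
  + by subst y; apply: irr xy.
  + exact: irr yx.
  + by case: i j ij ji => [] [].
- by move=> ->.
- by move=> ->.
- move=> uNv.
  have [eq_xy|/total[]] := pselect (x = y); [|by left; left|by right; left].
  subst y; case: i j uNv => [] [] // _; [right | left]; by right.
- by case: i; auto.
- by case: j; auto.
Qed.

Lemma basis_check_tournament (B : digraph) : basis_check B -> is_tournament B.
Proof.
have [To Uo Ho Ko] := TUHK_tournament omega_tournament.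
have [Ts Us Hs Ks] := TUHK_tournament omega_star_tournament.
case; rewrite ?/K_check_omega;
  auto using C3_dot_tournament, V_tournament, induced_tournament,
    omega_tournament, omega_star_tournament.
Qed.

Lemma basis_check_infinite (B : digraph) :
  basis_check B -> infinite_set [set: B].
Proof.
have K_vertex (n : nat) : (n, true) \in ~` [set (0%N, false)] by rewrite inE.
case; [> by apply: (infinite_injective (f := fun n => (n, ord0))) => m n []
  | by apply: (infinite_injective (f := fun n => (n, ord0))) => m n []
  | by apply: (infinite_injective (f := fun n => Some (n, true))) => m n []
  | by apply: (infinite_injective (f := fun n => Some (n, true))) => m n []
  | ..
  | by apply: (infinite_injective (f := fun n => SigSub (K_vertex n))) => m n []
  | by apply: (infinite_injective (f := fun n => (n, true))) => m n []].
all: by apply: (infinite_injective (f := fun n => (n, true))) => m n [].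
Qed.

(** * Acyclic indecomposability of the twelve members of the basis *)

Lemma C3_dot_indecomposable (C : digraph) :
  is_tournament C -> acyclically_indecomposable (C3_dot C).
Proof.
move=> tourC.
apply: indecomposableI (C3_dot_tournament tourC) _ => A closed nocycle.
have fiber x (i j : 'I_3) : j = i + 1 %[mod 3] -> A (x, i) -> A (x, j) -> False.
  move=> ij Ai Aj; pose k : 'I_3 := inord ((i + 2) %% 3).
  have kE : k = (i + 2) %% 3 :> nat by rewrite inordK // ltn_pmod.
  apply: (nocycle _ _ (x, k) Ai Aj); right; split=> //=; lia.
move=> [x i] [y j] Au Av /= [xy|[/= eq_xy ij]]; last first.
  by subst y; apply: fiber ij Au Av.
(* For x < y, the successor of (x, i) in its own copy lies between (x, i) and (y, j), which brings
   the case back to a single copy. *)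
pose k : 'I_3 := inord ((i + 1) %% 3).
have kE : k = i + 1 %[mod 3] by rewrite inordK ?ltn_pmod // modn_mod.
by apply: (fiber x i k kE Au); apply: closed Au Av _ _; [right | left].
Qed.

Lemma V_indecomposable (C : digraph) :
  is_tournament C -> acyclically_indecomposable (V_ C).
Proof.
move=> tourC; apply: indecomposableI (V_tournament tourC) _ => A closed nocycle.
have fiber x : A (Some (x, false)) -> A (Some (x, true)) -> False.
  move=> A0 A1; apply: (nocycle _ _ None A0 A1) => //=; by right.
have none i x : A None -> A (Some (x, i)) -> False.
  case: i => AN A1.
    by apply: (nocycle _ _ (Some (x, false)) A1 AN) => //=; right.
  by apply: (nocycle _ _ (Some (x, true)) AN A1) => //=; right.
move=> [[x i]|] [[y j]|] Au Av //=;
  [|by move=> _; apply: none Av Au|by move=> _; apply: none Au Av].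
case=> [xy|[eq_xy]]; last first.
  by subst y; case: i j Au Av => [] [] // + + _; apply: fiber.
(* For x < y, a vertex between the two ends always reduces to [fiber] or [none]: (x, 1) if i = 0,
   (y, 0) if i = j = 1, and the vertex a if i = 1 and j = 0. *)
case: i Au => Au; last first.
  by apply: (fiber x Au); apply: closed Au Av _ _; [right|left].
case: j Av => Av.
  by apply: (fiber y _ Av); apply: closed Au Av _ _; [left|right].
by apply: (none true x _ Au); apply: closed Au Av _ _.
Qed.

Definition transitive_arc (C : digraph) : Prop :=
  forall x y z : C, arc x y -> arc y z -> arc x z.

(** Every arc lies on a 3-cycle. For the arcs [T_vert] and [T_cross2] the third vertex comes from a
    further element of the chain, above or below according to which end is missing. *)
Lemma T_indecomposable (C : digraph) : is_tournament C -> transitive_arc C ->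
    (forall x : C, exists y, arc x y) \/ (forall x : C, exists y, arc y x) ->
  acyclically_indecomposable (T_ C).
Proof.
move=> tourC trans noend; have [tourT _ _ _] := TUHK_tournament tourC.
apply: indecomposableI tourT _ => A closed nocycle u v Au Av uv.
case: uv Au Av => [x|x y xy|x y xy|x y xy|x y xy] Au Av.
- case: noend => /(_ x)[y xy].
    exact: (nocycle _ _ _ Au Av (T_vert x) (T_top xy) (T_cross1 xy)).
  exact: (nocycle _ _ _ Au Av (T_vert x) (T_cross1 xy) (T_base xy)).
- exact: (nocycle _ _ _ Au Av (T_base xy) (T_vert y) (T_cross1 xy)).
- exact: (nocycle _ _ _ Au Av (T_top xy) (T_cross1 xy) (T_vert x)).
- exact: (nocycle _ _ _ Au Av (T_cross1 xy) (T_vert x) (T_top xy)).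
case: noend => [/(_ y)[z yz]|/(_ x)[z zx]].
  exact: (nocycle _ _ _ Au Av (T_cross2 xy) (T_top (trans _ _ _ xy yz))
    (T_cross1 yz)).
exact: (nocycle _ _ _ Au Av (T_cross2 xy) (T_cross1 zx)
  (T_base (trans _ _ _ zx xy))).
Qed.

(** Two vertices of level 1 lie on a 3-cycle; closure under betweenness reduces the base arcs and
    the arcs [U_cross1] to a fiber, and a fiber to level 1 when a larger element is available. *)
Lemma U_indecomposable (C : digraph) : is_tournament C ->
    (forall x : C, exists y, arc x y) \/ (forall x : C, exists y, arc y x) ->
  acyclically_indecomposable (U_ C).
Proof.
move=> tourC noend; have [_ tourU _ _] := TUHK_tournament tourC.
apply: indecomposableI tourU _ => A closed nocycle.
have top x y : arc x y -> A (x, true) -> A (y, true) -> False.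
  move=> xy Ax Ay.
  exact: (nocycle _ _ _ Ay Ax (U_top xy) (U_cross2 xy) (U_vert y)).
have vert x : A (x, false) -> A (x, true) -> False.
  move=> A0 A1; case: noend => /(_ x)[y xy].
    apply: (top _ _ xy A1); apply: closed A0 A1 (U_cross1 xy) (U_top xy).
  exact: (nocycle _ _ _ A0 A1 (U_vert x) (U_top xy) (U_cross2 xy)).
move=> u v Au Av uv; case: uv Au Av => [x|x y xy|x y xy|x y xy|x y xy] Au Av.
- exact: vert Au Av.
- by apply: (vert x Au); apply: closed Au Av (U_vert x) (U_cross2 xy).
- exact: top xy Av Au.
- by apply: (vert y _ Av); apply: closed Au Av (U_base xy) (U_vert y).
- exact: (nocycle _ _ _ Au Av (U_cross2 xy) (U_vert y) (U_top xy)).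
Qed.

Lemma H_indecomposable (C : digraph) : is_tournament C -> transitive_arc C ->
    (forall x : C, exists y, arc x y) \/ (forall x : C, exists y, arc y x) ->
  acyclically_indecomposable (H_ C).
Proof.
move=> tourC trans noend; have [_ _ tourH _] := TUHK_tournament tourC.
apply: indecomposableI tourH _ => A closed nocycle.
have base x y : arc x y -> A (x, false) -> A (y, false) -> False.
  move=> xy Ax Ay.
  exact: (nocycle _ _ _ Ax Ay (H_base xy) (H_vert y) (H_cross1 xy)).
have top x y : arc x y -> A (x, true) -> A (y, true) -> False.
  move=> xy Ax Ay.
  exact: (nocycle _ _ _ Ax Ay (H_top xy) (H_cross1 xy) (H_vert x)).
move=> u v Au Av uv; case: uv Au Av => [x|x y xy|x y xy|x y xy|x y xy] Au Av.
- case: noend => /(_ x)[y xy].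
    exact: (nocycle _ _ _ Au Av (H_vert x) (H_top xy) (H_cross1 xy)).
  exact: (nocycle _ _ _ Au Av (H_vert x) (H_cross1 xy) (H_base xy)).
- exact: base xy Au Av.
- exact: top xy Au Av.
- exact: (nocycle _ _ _ Au Av (H_cross1 xy) (H_base xy) (H_vert y)).
case: noend => [/(_ y)[z yz]|/(_ x)[z zx]].
  have xz := trans _ _ _ xy yz; apply: (top x z xz Au).
  exact: closed Au Av (H_top xz) (H_cross1 yz).
have zy := trans _ _ _ zx xy; apply: (base z y zy _ Av).
exact: closed Au Av (H_cross1 zx) (H_base zy).
Qed.

(** In [K_ omega] the pair (0, 0), (0, 1) is autonomous and acyclic. The image of [f] must thus
    contain only those base vertices that have an element of the chain below them; this form covers
    both [K_check_omega] and [K_ omega_star]. *)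
Lemma sub_K_indecomposable (C B : digraph) (f : B -> K_ C) :
    is_tournament B -> transitive_arc C ->
    (forall a b, arc a b <-> arc (f a) (f b)) ->
    (forall x, range f (x, true)) ->
    (forall x y, arc x y -> range f (y, false)) ->
    (forall x, range f (x, false) -> exists z, arc z x) ->
  acyclically_indecomposable B.
Proof.
move=> tourB trans fE S1 S0 noend.
apply: indecomposableI tourB _ => A' closed' nocycle'.
(* The argument is carried out inside [K_ C], where arcs can be analysed by constructor; only third
   vertices in the range of [f] may be used. *)
pose A u := exists2 a, f a = u & A' a.
have closed u v w : range f w -> A u -> A v -> arc u w -> arc w v -> A w.
  move=> [c _ <-] [a <- Aa] [b <- Ab] /fE ac /fE cb.
  by exists c => //; apply: closed' Aa Ab ac cb.
have nocycle u v w :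
    range f w -> A u -> A v -> arc u v -> arc v w -> arc w u -> False.
  move=> [c _ <-] [a <- Aa] [b <- Ab] /fE ab /fE bc /fE ca.
  exact: (nocycle' a b c Aa Ab ab bc ca).
suff noarc u v : range f u -> range f v -> A u -> A v -> arc u v -> False.
  by move=> a b Aa Ab /fE; apply: noarc;
    [exists a | exists b | exists a | exists b].
have top x y : arc x y -> A (x, true) -> A (y, true) -> False.
  move=> xy Ax Ay.
  exact: (nocycle _ _ _ (S0 _ _ xy) Ay Ax (K_top xy) (K_cross2 xy) (K_vert y)).
move=> Su Sv Au Av uv.
case: uv Su Sv Au Av => [x|x y xy|x y xy|x y xy|x y xy] Su Sv Au Av.
- have [z zx] := noend _ Su.
  exact: (nocycle _ _ _ (S1 z) Au Av (K_vert x) (K_top zx) (K_cross2 zx)).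
- exact: (nocycle _ _ _ (S1 y) Au Av (K_base xy) (K_vert y) (K_cross1 xy)).
- exact: top xy Av Au.
- have [z zx] := noend _ Sv; have zy := trans _ _ _ zx xy.
  apply: (top z y zy _ Au).
  exact: (closed _ _ _ (S1 z) Au Av (K_top zy) (K_cross2 zx)).
- exact: (nocycle _ _ _ (S1 y) Au Av (K_cross2 xy) (K_vert y) (K_top xy)).
Qed.

Lemma basis_check_indecomposable (B : digraph) :
  basis_check B -> acyclically_indecomposable B.
Proof.
have trans : transitive_arc omega by move=> x y z; apply: ltn_trans.
have trans_star : transitive_arc omega_star.
  by move=> x y z /= yx zy; apply: ltn_trans yx.
have noend : (forall x : omega, exists y, arc x y) \/
    (forall x : omega, exists y, arc y x).
  by left=> x; exists x.+1; apply: ltnSn.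
have noend_star : (forall x : omega_star, exists y, arc x y) \/
    (forall x : omega_star, exists y, arc y x).
  by right=> x; exists x.+1; apply: ltnSn.
move=> BB; have := basis_check_tournament BB.
case: BB => [_|_|_|_|_|_|_|_|_|_|tourK|tourK].
- exact: C3_dot_indecomposable omega_tournament.
- exact: C3_dot_indecomposable omega_star_tournament.
- exact: V_indecomposable omega_tournament.
- exact: V_indecomposable omega_star_tournament.
- exact: T_indecomposable omega_tournament trans noend.
- exact: T_indecomposable omega_star_tournament trans_star noend_star.
- exact: U_indecomposable omega_tournament noend.
- exact: U_indecomposable omega_star_tournament noend_star.
- exact: H_indecomposable omega_tournament trans noend.
- exact: H_indecomposable omega_star_tournament trans_star noend_star.
- have inK (u : K_ omega) :
      u <> (0%N, false) -> range (val : K_check_omega -> _) u.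
    by move=> u0; exists (SigSub (mem_set u0 : u \in ~` [set (0%N, false)])).
  have := @sub_K_indecomposable omega K_check_omega val tourK trans; apply.
  + by [].
  + by move=> x; apply: inK.
  + by move=> x [//|y] _; apply: inK.
  + by move=> [|x] [a _ a0]; [case: (set_mem (valP a)) | exists 0].
- apply: (@sub_K_indecomposable omega_star _ id tourK trans_star) => //.
  by move=> x _; exists x.+1; apply: ltnSn.
Qed.

(** * Ramsey's theorem for pairs of naturals *)

Definition unbounded (S : nat -> Prop) : Prop :=
  forall n, exists2 m, n <= m & S m.

Lemma unbounded_pigeonhole (K : finType) (S : nat -> Prop) (f : nat -> K) :
  unbounded S -> exists k, unbounded (fun m => S m /\ f m = k).
Proof.
move=> Sinf; apply: contrapT => /forallNP noK.
have bound k : exists n, forall m, n <= m -> S m -> f m <> k.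
  apply: contrapT => /forallNP nobound; apply: (noK k) => n.
  apply: contrapT => noM; apply: (nobound n) => m le_nm Sm fm.
  by apply: noM; exists m.
have [N NP] := choice bound.
have [m le_Nm Sm] := Sinf (\max_k N k).
by apply: (NP (f m) m _ Sm) => //; apply: leq_trans le_Nm; apply: leq_bigmax.
Qed.

Lemma unbounded_enum (S : nat -> Prop) : unbounded S ->
  exists2 h : nat -> nat, {homo h : m n / m < n} & forall n, S (h n).
Proof.
move=> Sinf.
have ex n : exists m, n <= m /\ S m by have [m] := Sinf n; exists m.
have [g gP] := choice ex.
exists (fun n => iter n (fun m => g m.+1) (g 0)); last first.
  by case=> [|n] /=; apply: (gP _).2.
by apply: homo_ltn => [|n /=]; [exact: ltn_trans | exact: (gP _).1].
Qed.

Lemma ramsey (K : finType) (c : nat -> nat -> K) :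
  exists2 h : nat -> nat, {homo h : m n / m < n}
    & exists k, forall m n, m < n -> c (h m) (h n) = k.
Proof.
pose inf := {S | unbounded S}.
(* From an infinite S, choose a point x, a colour k and an infinite subset of S beyond x all of
   whose points have colour k with x. Iterating makes the colour of a pair depend on its smaller
   point only. *)
have step (S : inf) : exists r : nat * K * inf, sval S r.1.1 /\
    forall y, sval r.2 y -> [/\ sval S y, r.1.1 < y & c r.1.1 y = r.1.2].
  case: S => S Sinf; have [x _ Sx] := Sinf 0.
  have Sx_inf : unbounded (fun y => S y /\ x < y).
    by move=> n; have [y] := Sinf (maxn n x.+1);
       rewrite geq_max => /andP[ny xy] Sy; exists y.
  have [k kinf] := unbounded_pigeonhole (c x) Sx_inf.
  by exists (x, k, exist _ _ kinf) => /=; split=> // y [[]].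
have [next nextP] := choice step.
have allinf : unbounded (fun=> True) by move=> n; exists n.
pose S n := iter n (fun S => (next S).2) (exist _ _ allinf : inf).
pose x n := (next (S n)).1.1; pose k n := (next (S n)).1.2.
have S_anti m n y : m <= n -> sval (S n) y -> sval (S m) y.
  elim: n => [|n IHn]; first by rewrite leqn0 => /eqP->.
  rewrite leq_eqVlt => /predU1P[->//|]; rewrite ltnS => le_mn /=.
  by case/(nextP (S n)).2 => /(IHn le_mn).
have xP m n : m < n -> x m < x n /\ c (x m) (x n) = k m.
  move=> lt_mn; have := S_anti _ _ _ lt_mn (nextP (S n)).1.
  by case/(nextP (S m)).2.
(* One colour occurs infinitely often among the chosen points; keep those. *)
have [k0 k0inf] := unbounded_pigeonhole k allinf.
have [g g_incr gk0] := unbounded_enum k0inf.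
exists (x \o g); first by move=> m n /g_incr/xP[].
by exists k0 => m n /g_incr/xP[_ ->]; case: (gk0 m).
Qed.

Lemma infinite_injection (T : Type) : infinite_set [set: T] ->
  exists s : nat -> T, injective s.
Proof.
move=> /infiniteP/card_leP[f].
exists (fun n => val (f (SigSub (mem_setT n)))) => m n /val_inj.
by move/(@inj _ _ _ f _ _ (mem_setT _) (mem_setT _)) => [].
Qed.

(** Between tournaments, preserving arcs suffices: completeness of the source and irreflexivity of
    the target give injectivity, and antisymmetry of the target then gives reflection of arcs. *)
Lemma embedding_contains (T B : digraph) (f : B -> T) :
    is_tournament T -> is_tournament B ->
  (forall u v, arc u v -> arc (f u) (f v)) -> contains T B.
Proof.
move=> [T_irr T_anti _] [B_irr _ B_total] f_hom.
have f_inj : injective f.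
  move=> u v fuv; apply: contrapT => /B_total[] /f_hom; rewrite fuv;
    exact: T_irr.
exists (range f).
have fP u : f u \in range f by apply/mem_set; exists u.
have gP (a : range f) : exists u, f u = val a.
  by have [u _ fu] := set_mem (valP a); exists u.
have [g gK] := choice gP.
exists g => [|a b].
  exists (fun u => SigSub (fP u)) => [a | u]; first exact/val_inj/gK.
  exact/f_inj/gK.
rewrite /= -!gK; split=> [fab|]; last exact: f_hom.
have /B_total[//|/f_hom fba] : g a <> g b.
  by move=> gab; apply: (T_irr (f (g a))); rewrite {2}gab.
by case: (T_irr (f (g a))); rewrite {2}(T_anti _ _ fab fba).
Qed.

(** * Tables of orientations and a checker for disjunctions of facts *)

(** The value [None] stands for equality: vertices of different blocks may coincide, as when all
    blocks share a witness. *)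
Definition orientation (T : digraph) (x y : T) : option bool :=
  if `[< arc x y >] then Some true else if `[< arc y x >] then Some false
  else None.

Lemma orientation_eq (T : digraph) (x y : T) : is_tournament T ->
  match orientation x y with
  | Some true => arc x y
  | Some false => arc y x
  | None => x = y
  end.
Proof.
move=> [_ _ total]; rewrite /orientation.
case: asboolP => // nxy; case: asboolP => // nyx.
by apply: contrapT => /total[].
Qed.

Definition fact : eqType := ((nat * nat) * option bool)%type.

Definition holds (c : nat * nat -> option bool) (f : fact) : bool :=
  c f.1 == f.2.

(* [D] is a disjunction of conjunctions of facts [c v = o]; the search branches
   over the values of the variables [vars], simplifying [D] on the way. *)
Fixpoint tautology (D : seq (seq fact)) (vars : seq (nat * nat)) : bool :=
  if [::] \in D then true else
  if vars is v :: vars' then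
    all (fun o => tautology
      [seq [seq f <- K | f != (v, o)] | K <- D
        & all (fun f => (f.1 == v) ==> (f.2 == o)) K] vars')
      [:: Some true; Some false; None]
  else false.

(** Follow the branch of the actual value [c v]: conjunctions it contradicts are dropped and the
    fact it satisfies is erased, so a true conjunction of the simplified list comes from a true one
    of [D]. *)
Lemma tautology_sound D vars c : tautology D vars ->
  exists2 K, K \in D & all (holds c) K.
Proof.
elim: vars D => [|v vars IH] D /=; case: ifPn => [D0 _|_]; try by exists [::].
have {IH}sound o : c v = o ->
    tautology [seq [seq f <- K | f != (v, o)] | K <- D
      & all (fun f => (f.1 == v) ==> (f.2 == o)) K] vars ->
    exists2 K, K \in D & all (holds c) K.
  move=> cv /IH[K' /mapP[K]]; rewrite mem_filter => /andP[_ KD] -> Kc.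
  exists K => //; apply/allP => f fK.
  have [->|fv] := eqVneq f (v, o); first by rewrite /holds cv.
  by apply: (allP Kc); rewrite mem_filter fv.
by case/and4P => t f n _; case cv: (c v) => [[]|]; apply: (sound _ cv).
Qed.

(** * Arc patterns of the twelve tournaments *)

(* [g lt gt i j] tells whether (x, i) -> (y, j), where [lt] stands for x < y and
   [gt] for y < x. *)
Definition pattern := bool -> bool -> nat -> nat -> bool.

Definition dual (g : pattern) : pattern := fun lt gt => g gt lt.

Definition C3_pattern : pattern := fun lt gt i j =>
  if lt || gt then lt else j == i + 1 %[mod 3].

(* Label 2 is the vertex a, put in block 0; the blocks of the chain are shifted
   by one, so that a meets them only from below, even for omega_star. *)
Definition V_pattern (star : bool) : pattern := fun lt gt i j =>
  if i == 2 then lt && (j == 0) else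
  if j == 2 then gt && (i == 1) else
  if lt || gt then if star then gt else lt else i < j.

Definition T_pattern : pattern := fun lt gt i j =>
  if lt || gt then if i == j then lt else gt else i < j.

Definition U_pattern : pattern := fun lt gt i j =>
  if lt || gt then if (i == 1) && (j == 1) then gt else lt else i < j.

Definition H_pattern : pattern := fun lt gt i j =>
  if lt || gt then if i == j then lt else i == 1 else i < j.

Definition K_pattern : pattern := fun lt gt i j =>
  if lt || gt then if i == j then if i == 1 then gt else lt else i == 1
  else i < j.

Definition patterns : seq (nat * pattern) :=
  [:: (3, C3_pattern); (3, dual C3_pattern);
      (3, V_pattern false); (3, V_pattern true);
      (2, T_pattern); (2, dual T_pattern);
      (2, U_pattern); (2, dual U_pattern);
      (2, H_pattern); (2, dual H_pattern);
      (2, K_pattern); (2, dual K_pattern)].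

(** Only arcs are constrained, in one direction, as [embedding_contains] asks. The property passes
    to subtournaments, so [K_check_omega] follows [K_pattern]. *)
Definition follows (B : digraph) (p : nat * pattern) : Prop :=
  exists pos lab : B -> nat, forall u v, arc u v ->
    [/\ lab u < p.1, lab v < p.1
      & p.2 (pos u < pos v) (pos v < pos u) (lab u) (lab v)].

Lemma follows_basis i : i < size patterns ->
  exists2 B, basis_check B & follows B (nth (0, C3_pattern) patterns i).
Proof.
have lab2 (b : bool) : b < 2 by case: b.
have ltFgt m n : m < n -> (n < m) = false by lia.
case: i => [|[|[|[|[|[|[|[|[|[|[|[|//]]]]]]]]]]]] _ /=.
- exists (C3_dot omega); first exact: basis_C3_omega.
  exists (fun u => u.1), (fun u => u.2) => -[x i] [y j] /= xy; split=> //.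
  by rewrite /C3_pattern; case: xy => [xy|[-> ->]]; rewrite ?xy ?ltnn ?eqxx.
- exists (C3_dot omega_star); first exact: basis_C3_omega_star.
  exists (fun u => u.1), (fun u => u.2) => -[x i] [y j] /= xy; split=> //.
  by rewrite /dual /C3_pattern;
    case: xy => [xy|[-> ->]]; rewrite ?xy ?ltnn ?eqxx.
- exists (V_ omega); first exact: basis_V_omega.
  exists (fun u => if u is Some w then w.1.+1 else 0),
         (fun u => if u is Some w then nat_of_bool w.2 else 2).
  move=> [[x []]|] [[y []]|] //= xy; split=> //; rewrite /V_pattern ?ltnS //=;
  by case: xy => [/[dup] xy /ltFgt yx|[-> ]]; rewrite ?xy ?yx ?ltnn.
- exists (V_ omega_star); first exact: basis_V_omega_star.
  exists (fun u => if u is Some w then w.1.+1 else 0),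
         (fun u => if u is Some w then nat_of_bool w.2 else 2).
  move=> [[x []]|] [[y []]|] //= xy; split=> //; rewrite /V_pattern ?ltnS //=;
  by case: xy => [/[dup] xy /ltFgt yx|[-> ]]; rewrite ?xy ?yx ?ltnn.
all: [> exists (T_ omega) | exists (T_ omega_star) | exists (U_ omega)
      | exists (U_ omega_star) | exists (H_ omega) | exists (H_ omega_star)
      | exists K_check_omega | exists (K_ omega_star)]; try by constructor.
all: [> exists (fun u => u.1), (fun u => u.2)..
      | exists (fun u => (val u).1), (fun u => (val u).2)
      | exists (fun u => u.1), (fun u => u.2)].
all: move=> u v [x | x y /[dup] /ltFgt yx xy | x y /[dup] /ltFgt yx xy
                   | x y /[dup] /ltFgt yx xy | x y /[dup] /ltFgt yx xy].
all: split=> //=; rewrite /dual /T_pattern /U_pattern /H_pattern /K_pattern.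
all: by rewrite ?ltnn //= yx xy.
Qed.

(** * Embeddings of the patterns read off from a table *)

Definition grid m n : seq (nat * nat) :=
  [seq (i, j) | i <- iota 0 m, j <- iota 0 n].

Lemma mem_grid m n v : (v \in grid m n) = (v.1 < m) && (v.2 < n).
Proof.
apply/allpairsP/andP => [[[i j] [/= + + ->]]|[v1 v2]]; rewrite ?mem_iota //.
by exists v; rewrite !mem_iota; case: v v1 v2.
Qed.

(* The place (b, i) of a label l sends the vertex (x, l) of a pattern to label i
   of block 2x + b. *)
Definition place : Type := bool * nat.

Definition spot (s : seq place) (x l : nat) : nat * nat :=
  let p := nth (false, 0) s l in (x.*2 + p.1, p.2).

(* As only the order of blocks matters, blocks 0 and 1 of [p] suffice. *)
Definition required (p : nat * pattern) (s : seq place) :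
    seq ((nat * nat) * (nat * nat)) :=
  [seq (spot s a.1 a.2, spot s b.1 b.2)
    | a <- grid 2 p.1,
      b <- [seq b <- grid 2 p.1
             | p.2 (a.1 < b.1) (b.1 < a.1) a.2 b.2]].

(** Required arcs inside one block must be arcs of the witness. Those between two blocks become the
    facts of [clause], always read from the earlier block to the later, whence the swapped pair with
    [Some false]. *)
Definition admissible (E : seq (nat * nat)) p s : bool :=
  all (fun e => (e.1.1 != e.2.1) || ((e.1.2, e.2.2) \in E)) (required p s).

Definition clause p s : seq fact :=
  [seq if e.1.1 < e.2.1 then ((e.1.2, e.2.2), Some true)
       else ((e.2.2, e.1.2), Some false)
    | e <- required p s & e.1.1 != e.2.1].

(** Here [t n i] is the vertex labelled [i] in block [n], [E] lists arcs common to all blocks, and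
    [c] is the homogeneous table. *)
Definition tabulated (T : digraph) (t : nat -> nat -> T)
    (E : seq (nat * nat)) (c : nat * nat -> option bool) : Prop :=
  (forall n e, e \in E -> arc (t n e.1) (t n e.2)) /\
  (forall m n i j, m < n -> orientation (t m i) (t n j) = c (i, j)).

Lemma clause_contains (T B : digraph) (t : nat -> nat -> T) E c p s :
    is_tournament T -> is_tournament B -> follows B p -> tabulated t E c ->
  admissible E p s -> all (holds c) (clause p s) -> contains T B.
Proof.
move=> tourT tourB [pos [lab posP]] [tE tc] sE sc.
pose f u := let q := nth (false, 0) s (lab u) in t ((pos u).*2 + q.1) q.2.
apply: (embedding_contains (f := f)) => // u v /posP[lab_u lab_v uv].
(* The positions of u and v are replaced by their ranks 0 or 1, both 0 if equal, so that the arc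
   appears in [required]. *)
pose e := (spot s (pos v < pos u) (lab u), spot s (pos u < pos v) (lab v)).
have lt2 (b : bool) : b < 2 by case: b.
have e_req : e \in required p s.
  apply/allpairsPdep.
  exists ((pos v < pos u) : nat, lab u), ((pos u < pos v) : nat, lab v).
  rewrite mem_filter !mem_grid /= !lt2 lab_u lab_v !andbT; split=> //.
  by move: uv; case: ltngtP.
have e_sE := allP sE _ e_req.
have e_sc : e.1.1 != e.2.1 -> holds c (if e.1.1 < e.2.1
    then ((e.1.2, e.2.2), Some true) else ((e.2.2, e.1.2), Some false)).
  by move=> neq; apply: (allP sc); apply: map_f; rewrite mem_filter neq.
rewrite /f /=; move: e_sE e_sc; rewrite /e /spot /=.
set qu := nth _ s (lab u); set qv := nth _ s (lab v).
set a := _.*2 + _; set b := _.*2 + _; set A := _.*2 + _; set B' := _.*2 + _.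
(* Passing to ranks keeps the relative order of the two target blocks: [a], [b] are the reduced
   blocks, [A], [B'] the true ones. *)
have [ltE gtE] : (a < b) = (A < B') /\ (b < a) = (B' < A).
  rewrite /a /b /A /B'; case: (qu.1) => /=; case: (qv.1) => /=;
  case: (ltngtP (pos u) (pos v)) => ? /=; lia.
case: (ltngtP a b) ltE gtE => ab ltE gtE /=.
- move=> _ /(_ isT)/eqP /=; rewrite -(tc A B') //.
  by have := orientation_eq (t A qu.2) (t B' qv.2) tourT => /[swap] ->.
- move=> _ /(_ isT)/eqP /=; rewrite -(tc B' A) //.
  by have := orientation_eq (t B' qv.2) (t A qu.2) tourT => /[swap] ->.
move=> /(tE A) /= + _; suff -> : A = B' by [].
by move: ltE gtE; case: ltngtP.
Qed.

Fixpoint words (X : Type) (A : seq X) n : seq (seq X) :=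
  if n is n'.+1 then [seq a :: w | a <- A, w <- words A n'] else [:: [::]].

Definition clauses k E : seq (seq fact) :=
  flatten [seq [seq clause p s
             | s <- words [seq (b, i) | b <- [:: false; true], i <- iota 0 k] p.1
             & admissible E p s]
            | p <- patterns].

Lemma clauses_contains (T : digraph) (t : nat -> nat -> T) k E c K :
    is_tournament T -> tabulated t E c ->
    K \in clauses k E -> all (holds c) K ->
  exists2 B, basis_check B & contains T B.
Proof.
move=> tourT tab.
(* Patterns are functions, without decidable equality, so the pattern that yields [K] is located by
   [has] and an index. *)
suff: K \in clauses k E ->
    has (fun p => K \in [seq clause p s
      | s <- words [seq (b, i) | b <- [:: false; true], i <- iota 0 k] p.1
      & admissible E p s]) patterns.
  move=> /[apply] /(has_nthP (0, C3_pattern))[i /follows_basis[B BB Bi]].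
  case/mapP=> s; rewrite mem_filter => /andP[sE _] -> sc.
  exists B => //.
  exact: clause_contains tourT (basis_check_tournament BB) Bi tab sE sc.
rewrite /clauses; elim: patterns => //= p ps IH.
by rewrite mem_cat => /orP[->//|/IH->]; rewrite orbT.
Qed.

(* Conjunctions no table satisfies: labels 0 and 1 carry the monotone sequence
   of direction [d], and a label constant along the blocks is related to the
   other labels as within one block. *)
Definition absurdities k (E : seq (nat * nat)) (d : bool) : seq (seq fact) :=
  [seq [:: (v, o)] | v <- grid 2 2,
                     o <- [:: Some (~~ d); None]] ++
  [seq [:: (v, None)] | v <- grid k k
                      & (v \in E) || ((v.2, v.1) \in E)] ++
  flatten [seq [:: [:: ((e.1, e.1), None); (e, Some false)];
                   [:: ((e.2, e.2), None); (e, Some false)];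
                   [:: ((e.1, e.1), None); ((e.2, e.1), Some true)];
                   [:: ((e.2, e.2), None); ((e.2, e.1), Some true)]]
            | e <- E].

Lemma absurdities_fail (T : digraph) (t : nat -> nat -> T) k E c d K :
    is_tournament T -> tabulated t E c ->
    (forall i j, i < 2 -> j < 2 -> c (i, j) = Some d) ->
  K \in absurdities k E d -> ~~ all (holds c) K.
Proof.
move=> tourT [tE tc] cd; have [irr _ _] := tourT.
have cE m n i j : m < n -> match c (i, j) with
    | Some true => arc (t m i) (t n j)
    | Some false => arc (t n j) (t m i)
    | None => t m i = t n j
    end.
  by move=> mn; rewrite -(tc _ _ _ _ mn); apply: orientation_eq.
have asym (x y : T) : arc x y -> ~ arc y x by apply: tournament_asym.
rewrite mem_cat => /orP[|/[!mem_cat]/orP[]].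
- case/allpairsP=> -[v o] /= [+ oP ->]; rewrite mem_grid => /andP[v1 v2].
  rewrite /= /holds [v]surjective_pairing cd //.
  by move: oP; rewrite !inE => /pred2P[->|->]; case: (d).
- case/mapP=> v; rewrite mem_filter => /andP[vE _] ->; apply/negP.
  rewrite /= andbT => /eqP/= cv.
  (* Three blocks are compared: t 1 v.2 = t 0 v.1 = t 2 v.2 = t 1 v.1, so two labels joined by an
     arc would coincide in block 1. *)
  have cv' m n : m < n -> t m v.1 = t n v.2.
    by move=> mn; have := cE m n v.1 v.2 mn; rewrite -surjective_pairing cv.
  have eq1 : t 1 v.2 = t 1 v.1 by rewrite -(cv' 0 1) // (cv' 0 2) // (cv' 1 2).
  by case/orP: vE => /(tE 1) /=; rewrite eq1; apply: irr.
(* A label with equal vertices in blocks 0 and 1 turns an arc between these blocks into an arc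
   inside one of them, opposite to [e]. *)
- case/flattenP=> Ks /mapP[e eE ->].
  have c11 := cE 0 1 e.1 e.1 isT; have c22 := cE 0 1 e.2 e.2 isT.
  have c12 := cE 0 1 e.1 e.2 isT; have c21 := cE 0 1 e.2 e.1 isT.
  have e0 := tE 0 _ eE; have e1 := tE 1 _ eE.
  rewrite !inE => /or4P[]/eqP->;
  apply/negP => /and3P[] /eqP/= cc /eqP/= ce _;
  [move: c11 c12 | move: c22 c12 | move: c11 c21 | move: c22 c21];
  rewrite -?surjective_pairing cc ce => eq.
  + by rewrite eq => /asym; apply.
  + by rewrite -eq => /asym; apply.
  + by rewrite -eq => /asym; apply.
  + by rewrite eq => /asym; apply.
Qed.

(** * Witnesses of inequivalence and the finite verification *)

(* In each witness, labels 0 and 1 are the inequivalent vertices x -> y. *)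
Definition witnesses : seq (nat * seq (nat * nat)) :=
  [:: (3, [:: (0, 1); (1, 2); (2, 0)]);
      (4, [:: (0, 1); (0, 2); (2, 1); (3, 0); (3, 1); (2, 3)]);
      (4, [:: (0, 1); (0, 2); (2, 1); (0, 3); (1, 3); (3, 2)]);
      (5, [:: (0, 1); (0, 2); (0, 3); (0, 4); (2, 1); (3, 1); (4, 1);
              (2, 3); (3, 4); (4, 2)])].

Definition witness_at (w : 'I_4) : nat * seq (nat * nat) :=
  nth (0, [::]) witnesses w.

(* Deciding the diagonal entries first keeps the search small. *)
Definition entries k : seq (nat * nat) :=
  [seq (i, i) | i <- iota 0 k] ++
  flatten [seq [:: (i, j); (j, i)] | j <- iota 0 k, i <- iota 0 j].

(** This is the finite core: every table is absurd or contains one of the patterns. A single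
    computation settles the four witnesses and both directions. *)
Lemma witnesses_tautology (w : 'I_4) (d : bool) :
  tautology (absurdities (witness_at w).1 (witness_at w).2 d
             ++ clauses (witness_at w).1 (witness_at w).2)
            (entries (witness_at w).1).
Proof.
suff /(all_nthP (0, [::]))/(_ w (ltn_ord w))/and3P[t f _] :
    all (fun w => all (fun d =>
        tautology (absurdities w.1 w.2 d ++ clauses w.1 w.2) (entries w.1))
      [:: true; false]) witnesses.
  by case: d.
by vm_compute.
Qed.

Lemma indecomposable_witness (T : digraph) (x y : T) :
    is_tournament T -> acyclically_indecomposable T -> arc x y ->
  exists (w : 'I_4) (p : 'I_5 -> T), [/\ p (inord 0) = x, p (inord 1) = y
    & forall e, e \in (witness_at w).2 -> arc (p (inord e.1)) (p (inord e.2))].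
Proof.
move=> tourT indec xy; have [irr _ total] := tourT.
have asym (u v : T) : arc u v -> ~ arc v u by apply: tournament_asym.
have mk (i : nat) (s : seq T) : i < 4 -> nth x s 0 = x -> nth x s 1 = y ->
    all (fun e => (e.1 < 5) && (e.2 < 5)) (nth (0, [::]) witnesses i).2 ->
    {in (nth (0, [::]) witnesses i).2,
      forall e, arc (nth x s e.1) (nth x s e.2)} ->
  exists (w : 'I_4) (p : 'I_5 -> T), [/\ p (inord 0) = x, p (inord 1) = y
    & forall e, e \in (witness_at w).2 -> arc (p (inord e.1)) (p (inord e.2))].
  move=> i4 s0 s1 /allP lt5 sE; exists (Ordinal i4), (fun j => nth x s j).
  split; rewrite ?inordK // => e eE.
  by have /andP[e1 e2] := lt5 e eE; rewrite !inordK //; apply: sE.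
pose A : set T := fun w => [\/ w = x, w = y | arc x w /\ arc w y].
have xNy : x <> y by move=> eq_xy; apply: (irr x); rewrite {2}eq_xy.
have : ~ (autonomous A /\ acyclic (induced A)).
  by case=> autA acA; apply/xNy/(indec A) => //; [apply: Or31 | apply: Or32].
move=> /not_andP[|].
  move=> /existsNP[z /not_implyP[zNA /not_orP[/existsNP[a /not_implyP[aA nza]]
    /existsNP[b /not_implyP[bA nbz]]]]].
  have az : arc a z.
    by case: (total a z) => // [eq_az]; apply: zNA; rewrite -eq_az.
  have zb : arc z b.
    by case: (total z b) => // [eq_zb]; apply: zNA; rewrite eq_zb.
  have zNx : z <> x by move=> zx; apply: zNA; rewrite zx; apply: Or31.
  have zNy : z <> y by move=> zy; apply: zNA; rewrite zy; apply: Or32.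
  (* Here a -> z -> b with a, b in [A]. If z is below both x and y in the sense of arcs x -> z and y
     -> z, then b lies strictly between x and y; if z dominates both, a does; y -> z -> x is a
     3-cycle. *)
  have [xz|zx] := total x z (nesym zNx); have [yz|zy] := total y z (nesym zNy).
  - case: bA zb => [-> /asym//|-> /asym//|[xb yb] zb].
    apply: (mk 2 [:: x; y; b; z]) => // e; rewrite !inE.
    by do ?[case/predU1P=> [->//|]]; move/eqP->.
  - by case: zNA; apply: Or33.
  - apply: (mk 0 [:: x; y; z]) => // e; rewrite !inE.
    by do ?[case/predU1P=> [->//|]]; move/eqP->.
  - case: aA az => [-> /asym//|-> /asym//|[xa ya] az].
    apply: (mk 1 [:: x; y; a; z]) => // e; rewrite !inE.
    by do ?[case/predU1P=> [->//|]]; move/eqP->.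
move=> /existsNP[u /existsNP[v /existsNP[w /contrapT[]]]] /=.
(* In [A], x dominates all other vertices and y is dominated by all others, so a 3-cycle of [A]
   avoids both. *)
have inner (a b c : T) : A a -> A b -> A c -> arc a b -> arc c a ->
    arc x a /\ arc a y.
  case=> [->|->|//] Ab Ac ab ca; exfalso.
    by case: Ac ca => [->/irr|->/asym|[/asym]].
  by case: Ab ab => [->/asym|->/irr|[_ /asym]].
have Au := set_mem (valP u); have Av := set_mem (valP v).
have Aw := set_mem (valP w).
move=> uv vw wu; have [xu uy] := inner _ _ _ Au Av Aw uv wu.
have [xv vy] := inner _ _ _ Av Aw Au vw uv.
have [xw wy] := inner _ _ _ Aw Au Av wu vw.
apply: (mk 3 [:: x; y; val u; val v; val w]) => // e; rewrite !inE.
by do ?[case/predU1P=> [->//|]]; move/eqP->.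
Qed.

(** * Extraction of a basis member from an infinite tournament *)

Lemma indecomposable_contains (T : digraph) :
    is_tournament T -> infinite_set [set: T] -> acyclically_indecomposable T ->
  exists2 B, basis_check B & contains T B.
Proof.
move=> tourT /infinite_injection[s0 s0_inj] indec.
have [h h_incr [d hd]] := ramsey (fun m n => `[< arc (s0 m) (s0 n) >]).
pose s := s0 \o h.
have s_orient m n : m < n -> orientation (s m) (s n) = Some d.
  move=> mn; have := orientation_eq (s m) (s n) tourT.
  rewrite /orientation (hd _ _ mn); case: (d) => //; case: asboolP => // _.
  by move=> /s0_inj eq_h; have := h_incr _ _ mn; rewrite eq_h ltnn.
(* The pair of terms 2n and 2n + 1 is ordered according to [d], so that x n -> y n in both
   directions of the sequence. *)
pose x n := s (n.*2 + ~~ d); pose y n := s (n.*2 + d).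
have xy n : arc (x n) (y n).
  have := orientation_eq (s n.*2) (s n.*2.+1) tourT.
  by rewrite s_orient // /x /y; case: (d); rewrite addn0 addn1.
have [w wP] := choice (fun n => indecomposable_witness tourT indec (xy n)).
have {wP}[p pP] := choice wP.
(* The colour records the shape of the earlier witness and all 25 orientations between the two
   blocks; every block has a later one, so the shape is constant. *)
have [g g_incr [[v c] gP]] := ramsey (fun m n =>
  (w m, [ffun ij : 'I_5 * 'I_5 => orientation (p m ij.1) (p n ij.2)])).
have gw m : w (g m) = v by have [] := gP m m.+1 (ltnSn m).
pose t n i := p (g n) (inord i).
have tab : tabulated t (witness_at v).2 (fun ij => c (inord ij.1, inord ij.2)).
  split=> [n e|m n i j /gP[_ <-]]; last by rewrite ffunE.
  by have [_ _] := pP (g n); rewrite gw; apply.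
(* Labels 0 and 1 of a later block are later terms of [s], whence the direction [d]. *)
have dir i j : i < 2 -> j < 2 -> c (inord i, inord j) = Some d.
  move=> i2 j2; rewrite -(tab.2 0 1 i j) //.
  have tE n k : k < 2 -> t n k = s ((g n).*2 + (if k == 0 then ~~ d else d)).
    by case: k => [|[|//]] _; rewrite /t; case: (pP (g n)).
  rewrite !tE //; apply: s_orient; have := g_incr 0 1 isT.
  by case: eqP; case: eqP; case: (d) => /= _ _; lia.
have /(tautology_sound (fun ij => c (inord ij.1, inord ij.2)))[K] :=
  witnesses_tautology v d.
rewrite mem_cat => /orP[/(absurdities_fail tourT tab dir)/negP//|].
exact: clauses_contains tourT tab.
Qed.

Theorem theorem1p2 :
  (forall B : digraph, basis_check B ->
     [/\ is_tournament B, infinite_set [set: B]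
       & acyclically_indecomposable B]) /\
  (forall T : digraph,
     is_tournament T -> infinite_set [set: T] ->
     acyclically_indecomposable T ->
     exists2 B : digraph, basis_check B & contains T B).
Proof.
split=> [B BB|]; last exact: indecomposable_contains.
split; [exact: basis_check_tournament | exact: basis_check_infinite
  | exact: basis_check_indecomposable].
Qed.
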